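(* For any $0<k<n$ and any $1\le i\le n$ the diagram with rows $$qH^*_T(\mathrm{Gr}(k-1;n))\xleftarrow{(-1)^{n-k+1-i}\psi_i}qH^*_T(\mathrm{Gr}(k;n))\xrightarrow{(-1)^{n-k-i}\psi_i^*}qH_T^*(\mathrm{Gr}(k+1;n)),$$ $$qH^*_T(\mathrm{Gr}(n-k+1;n))\xleftarrow{\psi^*_{n+1-i}}qH^*_T(\mathrm{Gr}(n-k;n))\xrightarrow{\psi_{n+1-i}}qH_T^*(\mathrm{Gr}(n-k-1;n))$$ and vertical maps $\Theta_{k-1},\Theta_k,\Theta_{k+1}$ from the first row to the second is commutative, i.e. $$\Theta_{k-1}\circ(-1)^{n-k+1-i}\psi_i=\psi^*_{n+1-i}\circ\Theta_k,\qquad\Theta_{k+1}\circ(-1)^{n-k-i}\psi^*_i=\psi_{n+1-i}\circ\Theta_k .$$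
   Context: Fix $n\ge2$; $R=\mathbb{Z}[y_1,\ldots,y_n]$. For $0\le k\le n$, $qH_T^*(\mathrm{Gr}(k;n))$ (the $T$-equivariant quantum cohomology) is a free $R[q^{\pm1}]$-module with basis the Schubert classes $\sigma_\lambda$, $\lambda$ a partition inside the $k\times(n-k)$ rectangle. It is identified with $\bigwedge^k(R[q^{\pm1}]^n)$ by $\sigma_\lambda\leftrightarrow v_{w_1}\wedge\cdots\wedge v_{w_k}$, where $w_j=\lambda_{k+1-j}+j$ and $v_1,\ldots,v_n$ is the standard basis. Under these identifications $\psi_i^*=v_i\wedge\cdot$ and $\psi_i$ is contraction with the dual basis vector, $\psi_i(v_{j_1}\wedge\cdots\wedge v_{j_k})=\sum_r(-1)^{r-1}\delta_{i,j_r}v_{j_1}\wedge\cdots\widehat{v_{j_r}}\cdots\wedge v_{j_k}$, extended $R$-linearly; the quantum parameters $q=q_k$ of the different rings are related to one common parameter $z$ by $q_k=(-1)^{k-1}z$, and $\psi_i,\psi_i^*$ are linear in $z$. The level-rank map $\Theta_k:qH_T^*(\mathrm{Gr}(k;n))\to qH_T^*(\mathrm{Gr}(n-k;n))$ is the anti-linear map $f\cdot\sigma_\lambda\mapsto f'\cdot\sigma_{\lambda'}$, where $\lambda'$ is the conjugate partition and $f'(y_1,\ldots,y_n;q)=f(-y_n,\ldots,-y_1;q)$ for $f\in R[q^{\pm1}]$. *)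

(* Defs.v *)
From HB Require Import structures.
From mathcomp Require Import all_boot all_order all_algebra.
From mathcomp Require Import finmap.
From mathcomp.multinomials Require Import mpoly.
(* monalg and mpoly both define [mcoeff], [msupp], [mmap] and a notation
   [{mpoly R[n]}].  Below, the identifiers are those of monalg and the
   notations those of mpoly. *)
From mathcomp.multinomials Require Import -(notations) monalg.

Set Implicit Arguments.
Unset Strict Implicit.
Unset Printing Implicit Defensive.

Import Order.TTheory GRing.Theory Num.Theory.

Local Open Scope ring_scope.

(* [malg int R] is a ring in monalg only for exponents without nontrivial
   units, so the product of Laurent polynomials is defined here. *)
Definition laurent (R : comNzRingType) : Type := malg int R.

Section LaurentRing.
Variable R : comNzRingType.
Implicit Types (f g : laurent R) (a b : R) (m p : int).

HB.instance Definition _ := GRing.Zmodule.on (laurent R).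

Definition laurent_mono m a : laurent R := mkmalgU m a.

Definition laurent_mul f g : laurent R :=
  \sum_(m <- msupp f) \sum_(p <- msupp g)
    laurent_mono (m + p) (mcoeff m f * mcoeff p g).

Definition laurent_one : laurent R := laurent_mono 0 1.

Lemma laurent_mono0 m : laurent_mono m 0 = 0.
Proof. exact: monalgU0. Qed.

Lemma laurent_monoD m a b :
  laurent_mono m (a + b) = laurent_mono m a + laurent_mono m b.
Proof. exact: monalgUD. Qed.

Lemma laurentE f : f = \sum_(m <- msupp f) laurent_mono m (mcoeff m f).
Proof. exact: monalgE. Qed.

Lemma laurent_mulEw (d1 d2 : {fset int}) f g :
  (msupp f `<=` d1)%fset -> (msupp g `<=` d2)%fset ->
  laurent_mul f g = \sum_(m <- d1) \sum_(p <- d2)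
    laurent_mono (m + p) (mcoeff m f * mcoeff p g).
Proof.
move=> le1 le2; rewrite /laurent_mul (big_fset_incl _ le1) /=.
  apply/eq_bigr=> m _; apply/big_fset_incl => // p _ /mcoeff_outdom ->.
  by rewrite mulr0 laurent_mono0.
move=> m _ /mcoeff_outdom fm.
by rewrite big1 => // p _; rewrite fm mul0r laurent_mono0.
Qed.

Lemma laurent_mulC : commutative laurent_mul.
Proof.
move=> f g; rewrite /laurent_mul exchange_big /=.
by apply/eq_bigr=> m _; apply/eq_bigr=> p _; rewrite addrC mulrC.
Qed.

Lemma laurent_mulDl : left_distributive laurent_mul +%R.
Proof.
move=> f1 f2 g; pose d := (msupp f1 `|` msupp f2)%fset.
rewrite (@laurent_mulEw d (msupp g) (f1 + f2)) ?msuppD_le ?fsubset_refl //.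
rewrite (@laurent_mulEw d (msupp g) f1) ?fsubsetUl ?fsubset_refl //.
rewrite (@laurent_mulEw d (msupp g) f2) ?fsubsetUr ?fsubset_refl //.
rewrite -big_split /=; apply/eq_bigr=> m _.
rewrite -big_split /=; apply/eq_bigr=> p _.
by rewrite mcoeffD mulrDl laurent_monoD.
Qed.

Lemma laurent_mulDr : right_distributive laurent_mul +%R.
Proof.
by move=> f g h; rewrite laurent_mulC laurent_mulDl !(laurent_mulC f).
Qed.

Lemma laurent_mul0g : left_zero 0 laurent_mul.
Proof. by move=> g; rewrite /laurent_mul msupp0 big_seq_fset0. Qed.

Lemma laurent_mulg0 : right_zero 0 laurent_mul.
Proof. by move=> g; rewrite laurent_mulC laurent_mul0g. Qed.

Lemma laurent_mul_mono m a p b :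
  laurent_mul (laurent_mono m a) (laurent_mono p b) =
  laurent_mono (m + p) (a * b).
Proof.
rewrite (@laurent_mulEw [fset m]%fset [fset p]%fset) ?msuppU_le //.
by rewrite !big_seq_fset1 !mcoeffUU.
Qed.

Lemma laurent_ind (P : laurent R -> Prop) :
  P 0 -> (forall f g, P f -> P g -> P (f + g)) ->
  (forall m a, P (laurent_mono m a)) -> forall f, P f.
Proof.
by move=> P0 PD PU f; rewrite [f]laurentE; apply: (big_ind P) => // m _.
Qed.

Lemma laurent_mulA : associative laurent_mul.
Proof.
move=> f g h.
elim/laurent_ind: f => [|f1 f2 IH1 IH2|m a]; first by rewrite !laurent_mul0g.
  by rewrite !laurent_mulDl IH1 IH2.
elim/laurent_ind: g => [|g1 g2 IH1 IH2|p b].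
- by rewrite !(laurent_mul0g, laurent_mulg0).
- by rewrite !(laurent_mulDl, laurent_mulDr) IH1 IH2.
elim/laurent_ind: h => [|h1 h2 IH1 IH2|r c]; first by rewrite !laurent_mulg0.
  by rewrite !laurent_mulDr IH1 IH2.
by rewrite !laurent_mul_mono addrA mulrA.
Qed.

Lemma laurent_mul1g : left_id laurent_one laurent_mul.
Proof.
elim/laurent_ind => [|g1 g2 IH1 IH2|p b]; first exact: laurent_mulg0.
  by rewrite laurent_mulDr IH1 IH2.
by rewrite laurent_mul_mono add0r mul1r.
Qed.

Lemma laurent_one_neq0 : laurent_one != 0.
Proof.
apply/eqP=> /(congr1 (mcoeff 0)) /eqP.
by rewrite mcoeffUU mcoeff0 oner_eq0.
Qed.

HB.instance Definition _ := GRing.Zmodule_isComNzRing.Build (laurent R)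
  laurent_mulA laurent_mulC laurent_mul1g laurent_mulDl laurent_one_neq0.

End LaurentRing.

Arguments laurent_mono {R} m a.

(* The substitution t := s * t; only s = 1 and s = -1 are used. *)
Definition laurent_rescale (R : comNzRingType) (s : int) (f : laurent R) :
    laurent R :=
  mmap (laurent_mono 0) (fun m => laurent_mono m (s ^ m)%:~R) f.

Lemma mcoeff_rescale (R : comNzRingType) (s m : int) (f : laurent R) :
  mcoeff m (laurent_rescale s f) = mcoeff m f * (s ^ m)%:~R.
Proof.
rewrite /laurent_rescale /mmap.
under eq_bigr => p _ do rewrite [_ * _]laurent_mul_mono add0r.
rewrite (raddf_sum (mcoeff m)) /=; under eq_bigr => p _ do rewrite mcoeffU.
have [m_in|m_out] := boolP (m \in msupp f).
  rewrite (big_fsetD1 m) //= eqxx mulr1n big_seq big1 ?addr0 // => p.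
  by rewrite in_fsetD1 => /andP[/negPf-> _]; rewrite mulr0n.
rewrite (mcoeff_outdom m_out) mul0r big_seq big1 // => p p_in.
by case: eqP => // pm; rewrite -pm p_in in m_out.
Qed.

Lemma rescale0 (R : comNzRingType) s : laurent_rescale s 0 = 0 :> laurent R.
Proof. by apply/malgP=> m; rewrite mcoeff_rescale mcoeff0 mul0r. Qed.

Lemma rescaleK (R : comNzRingType) (s : int) : s * s = 1 ->
  involutive (@laurent_rescale R s).
Proof.
move=> ss f; apply/malgP=> m; rewrite !mcoeff_rescale -mulrA -intrM.
by rewrite -exprzMl ?ss ?exp1rz ?mulr1 //; apply/unitrP; exists s.
Qed.

(* Z[y_1, ..., y_n] and Z[y_1, ..., y_n][t, t^-1], where y_(i+1) is ['X_i] and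
   t stands for q or for z, depending on the module under consideration. *)
Definition eqring (n : nat) : comNzRingType := {mpoly int[n]}.
Definition qeqring (n : nat) : comNzRingType := laurent (eqring n).

Definition rev_neg (n : nat) (a : {mpoly int[n]}) : {mpoly int[n]} :=
  a \mPo [tuple - 'X_(rev_ord i) | i < n].

Definition prime_subst (n : nat) (f : qeqring n) : qeqring n :=
  mmap (fun a => laurent_mono 0 (rev_neg a) : qeqring n)
       (fun m => laurent_mono m 1) f.

Lemma mcoeff_prime_subst (n : nat) (m : int) (f : qeqring n) :
  mcoeff m (prime_subst f) = rev_neg (mcoeff m f).
Proof.
rewrite /prime_subst /mmap.
under eq_bigr => p _ do rewrite [_ * _]laurent_mul_mono add0r mulr1.
rewrite (raddf_sum (mcoeff m)) /=; under eq_bigr => p _ do rewrite mcoeffU.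
have [m_in|m_out] := boolP (m \in msupp f).
  rewrite (big_fsetD1 m) //= eqxx mulr1n big_seq big1 ?addr0 // => p.
  by rewrite in_fsetD1 => /andP[/negPf-> _]; rewrite mulr0n.
rewrite (mcoeff_outdom m_out) [RHS]raddf0 big_seq big1 // => p p_in.
by case: eqP => // pm; rewrite -pm p_in in m_out.
Qed.

Lemma prime_subst0 (n : nat) : prime_subst (0 : qeqring n) = 0.
Proof.
by apply/malgP=> m; rewrite mcoeff_prime_subst mcoeff0 [LHS]raddf0.
Qed.

(* Partitions inside the k x (n - k) rectangle; none if k > n. *)
Definition is_part (n k : nat) (la : k.-tuple 'I_n.+1) : bool :=
  sorted geq (map val la) && all (fun a : 'I_n.+1 => a + k <= n)%N la.

Definition part (n k : nat) : predArgType :=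
  {la : k.-tuple 'I_n.+1 | is_part la}.

Definition conj_tuple (n k : nat) (la : k.-tuple 'I_n.+1) :
    (n - k).-tuple 'I_n.+1 :=
  [tuple inord (count (fun a : 'I_n.+1 => j < a)%N la) | j < n - k].

Lemma conj_tupleP (n k : nat) (la : part n k) : is_part (conj_tuple (val la)).
Proof.
have cle (j : 'I_(n - k)) :
    (count (fun a : 'I_n.+1 => j < a) (val la) <= k <= n)%N.
  apply/andP; split.
    by have := count_size (fun a : 'I_n.+1 => j < a)%N (val la); rewrite size_tuple.
  by rewrite ltnW // -subn_gt0 (leq_ltn_trans _ (ltn_ord j)).
have cval (j : 'I_(n - k)) : tnth (conj_tuple (val la)) j =
    count (fun a : 'I_n.+1 => j < a)%N (val la) :> nat.
  rewrite tnth_mktuple inordK // ltnS.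
  by have /andP[] := cle j; apply: leq_trans.
apply/andP; split; last first.
  apply/allP=> a /tnthP[j ->]; rewrite cval.
  have /andP[c_le k_le] := cle j.
  by rewrite -(leq_add2r (n - k)) subnKC in c_le.
apply/(sortedP 0%N) => j; rewrite size_map size_tuple => j_lt.
have j_lt' := ltnW j_lt.
have nthE (r : 'I_(n - k)) : nth 0%N (map val (conj_tuple (val la))) r =
    count (fun a : 'I_n.+1 => r < a)%N (val la).
  by rewrite (nth_map ord0) ?size_tuple // -tnth_nth; exact: cval.
rewrite /geq /= (nthE (Ordinal j_lt)) (nthE (Ordinal j_lt')) /=.
by apply: sub_count => a /=; exact: ltnW.
Qed.

Definition conj_part (n k : nat) (la : part n k) : part n (n - k) :=
  Sub (conj_tuple (val la)) (conj_tupleP la).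

(* The free module on the Schubert classes; the scalar t of [qeqring n] is the
   quantum parameter q_k. *)
Definition qH (n k : nat) : predArgType := {ffun part n k -> (qeqring n)^o}.

Definition schubert (n k : nat) (la : part n k) : qH n k :=
  [ffun mu => (mu == la)%:R].

Definition Theta (n k : nat) (x : qH n k) : qH n (n - k) :=
  \sum_(la : part n k) prime_subst (x la) *: schubert (conj_part la).

Lemma Theta_schubert (n k : nat) (f : qeqring n) (la : part n k) :
  Theta (f *: schubert la) = prime_subst f *: schubert (conj_part la).
Proof.
rewrite /Theta (bigD1 la) //= big1 ?addr0 => [|mu mula].
  by rewrite !ffunE eqxx [f *: _]mulr1.
by rewrite !ffunE (negPf mula) scaler0 prime_subst0 scale0r.
Qed.

(* The k-th exterior power, free on the v_(j_1) /\ ... /\ v_(j_k) with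
   j_1 < ... < j_k; the scalar t of [qeqring n] is z, and v_(j+1) has index
   [j : 'I_n]. *)
Definition incr (n k : nat) : predArgType :=
  {J : k.-tuple 'I_n | sorted ltn (map val J)}.

Definition extp (n k : nat) : predArgType := {ffun incr n k -> (qeqring n)^o}.

Definition inversions (n k : nat) (t : k.-tuple 'I_n) : nat :=
  #|[set p : 'I_k * 'I_k | (p.1 < p.2)%N && (tnth t p.2 < tnth t p.1)%N]|.

(* v_(t_1) /\ ... /\ v_(t_k): zero when [t] has a repetition, otherwise up to
   the sign of the sorting permutation a basis element. *)
Definition wedge (n k : nat) (t : k.-tuple 'I_n) : extp n k :=
  [ffun J : incr n k =>
     if perm_eq t (val J) then (-1) ^+ inversions t else 0].

(* v_i /\ u *)
Definition ext_mul (n : nat) (i : 'I_n) (k : nat) (u : extp n k) :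
    extp n k.+1 :=
  \sum_(J : incr n k) u J *: wedge [tuple of i :: val J].

Definition del_tuple (n k : nat) (r : 'I_k) (t : k.-tuple 'I_n) :
    (k.-1).-tuple 'I_n :=
  [tuple tnth t (lift r s) | s < k.-1].

(* Contraction of u with the vector dual to v_i.  Positions are counted from 0,
   whence the sign (-1) ^ r. *)
Definition ext_contract (n : nat) (i : 'I_n) (k : nat) (u : extp n k) :
    extp n k.-1 :=
  \sum_(J : incr n k) u J *:
    \sum_(r < k) ((-1) ^+ r * (i == tnth (val J) r)%:R) *:
      wedge (del_tuple r (val J)).

Lemma part_index_subproof (n k : nat) (la : part n k) (j : 'I_k) :
  (tnth (val la) (rev_ord j) + j < n)%N.
Proof.
have /andP[_ /allP/(_ _ (mem_tnth (rev_ord j) (val la)))] := valP la.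
by apply: leq_trans; rewrite -addnS leq_add2l.
Qed.

(* w_j = la_(k+1-j) + j, with all indices shifted to start from 0. *)
Definition part_tuple (n k : nat) (la : part n k) : k.-tuple 'I_n :=
  [tuple Ordinal (part_index_subproof la j) | j < k].

Lemma part_tupleP (n k : nat) (la : part n k) :
  sorted ltn (map val (part_tuple la)).
Proof.
apply/(sortedP 0%N) => j; rewrite size_map size_tuple => j_lt.
have j_lt' := ltnW j_lt; have /andP[/(sortedP 0%N) la_s _] := valP la.
have nthE (r : 'I_k) : nth 0%N (map val (part_tuple la)) r =
    (nth 0%N (map val (val la)) (rev_ord r) + r)%N.
  rewrite (nth_map (tnth (part_tuple la) r)) ?size_tuple //.
  rewrite -tnth_nth tnth_mktuple /= (nth_map ord0) ?size_tuple ?rev_ord_proof //.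
  by rewrite (tnth_nth ord0).
rewrite (nthE (Ordinal j_lt)) (nthE (Ordinal j_lt')) /= addnS ltnS leq_add2r.
have := la_s (k - j.+2)%N; rewrite size_map size_tuple -subSn // subSS.
by apply; rewrite ltn_subrL (leq_ltn_trans _ j_lt).
Qed.

Definition part_incr (n k : nat) (la : part n k) : incr n k :=
  Sub (part_tuple la) (part_tupleP la).

(* (-1) ^ (k - 1), the sign relating q_k and z. *)
Definition qsign (k : nat) : int := (-1) ^+ k.+1.

Definition to_extp (n k : nat) (x : qH n k) : extp n k :=
  \sum_(la : part n k)
    laurent_rescale (qsign k) (x la) *: wedge (part_tuple la).

Definition of_extp (n k : nat) (u : extp n k) : qH n k :=
  \sum_(la : part n k)
    laurent_rescale (qsign k) (u (part_incr la)) *: schubert la.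

Lemma qsign_sqr k : qsign k * qsign k = 1.
Proof. by rewrite -expr2 sqrr_sign. Qed.

Lemma incr_uniq (n k : nat) (J : incr n k) : uniq (val J).
Proof.
rewrite -(map_inj_uniq val_inj).
by apply: sorted_uniq (valP J); [exact: ltn_trans | exact: ltnn].
Qed.

Lemma perm_incr (n k : nat) (I J : incr n k) :
  perm_eq (val I) (val J) = (I == J).
Proof.
apply/idP/eqP => [IJ|-> //]; apply/val_inj/val_inj/(inj_map val_inj).
apply: (irr_sorted_eq ltn_trans ltnn (valP I) (valP J)).
exact/perm_mem/perm_map.
Qed.

Lemma incr_lt (n k : nat) (J : incr n k) (r s : 'I_k) :
  (r < s)%N -> (tnth (val J) r < tnth (val J) s)%N.
Proof.
move=> rs; have x0 := tnth (val J) r; rewrite !(tnth_nth x0).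
have := sorted_ltn_nth ltn_trans 0%N (valP J).
move=> /(_ r s); rewrite !inE size_map size_tuple !ltn_ord => /(_ isT isT rs).
by rewrite !(nth_map x0) ?size_tuple.
Qed.

Lemma wedge_incr (n k : nat) (I : incr n k) :
  wedge (val I) = [ffun J => (I == J)%:R].
Proof.
apply/ffunP=> J; rewrite !ffunE perm_incr; case: eqP => // _.
rewrite /inversions (_ : [set _ | _] = set0) ?cards0 //.
apply/setP=> -[r s]; rewrite !inE /=; apply/negP=> /andP[/(incr_lt I)].
by rewrite ltnNge => /negP nle sr; apply: nle; apply: ltnW.
Qed.

Lemma part_incr_inj (n k : nat) : injective (@part_incr n k).
Proof.
move=> la mu /(congr1 val) /= lamu; apply/val_inj/eq_from_tnth=> j.
have /(congr1 (fun t => val (tnth t (rev_ord j)))) := lamu.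
by rewrite !tnth_mktuple /= rev_ordK => /addIn /val_inj.
Qed.

Lemma part_incr_surj (n k : nat) (J : incr n k) :
  exists la : part n k, part_incr la = J.
Proof.
have gap (r s : 'I_k) : (r <= s)%N ->
    (tnth (val J) r + (s - r) <= tnth (val J) s)%N.
  elim: {s}(val s) {-2}s (erefl (val s)) => [|m IH] s sm rs.
    suff -> : s = r by rewrite subnn addn0.
    by apply/val_inj/eqP; rewrite eqn_leq rs andbT /= sm.
  have [/val_inj->|ne] := eqVneq (val r) (val s); first by rewrite subnn addn0.
  have r_lt : (r < s)%N by rewrite ltn_neqAle ne rs.
  have m_lt : (m < k)%N by have := ltn_ord s; rewrite [nat_of_ord s]sm => /ltnW.
  have rm : (r <= m)%N by rewrite -ltnS -sm.
  have /= := IH (Ordinal m_lt) erefl rm.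
  have : (tnth (val J) (Ordinal m_lt) < tnth (val J) s)%N.
    by apply: incr_lt; rewrite /= sm.
  move=> lt le; rewrite sm subSn // addnS; exact: leq_ltn_trans le lt.
have ge_id (j : 'I_k) : (j <= tnth (val J) j)%N.
  have k_gt0 : (0 < k)%N by apply: leq_ltn_trans (ltn_ord j).
  have := gap (Ordinal k_gt0) j (leq0n _).
  by rewrite /= subn0; apply: leq_trans; rewrite leq_addl.
pose a (j : 'I_k) := (tnth (val J) j - j)%N.
have a_mono (r s : 'I_k) : (r <= s)%N -> (a r <= a s)%N.
  move=> rs; rewrite leq_subRL // (leq_trans _ (gap _ _ rs)) //.
  by rewrite /a -{2}(subnK (ge_id r)) -addnA subnKC // addnC.
have a_bound (j : 'I_k) : (a j + k <= n)%N.
  have k_gt0 : (0 < k)%N by apply: leq_ltn_trans (ltn_ord j).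
  have last_lt : (k.-1 < k)%N by rewrite prednK.
  have j_le : (j <= Ordinal last_lt)%N by rewrite /= -ltnS prednK.
  have := leq_ltn_trans (gap _ _ j_le) (ltn_ord _); apply: leq_trans.
  rewrite /= -{1}(prednK k_gt0) addnS ltnS -{1}(subnK (ge_id j)) -addnA leq_add2l.
  by rewrite subnKC // -ltnS prednK.
have a_lt (j : 'I_k) : (a j < n.+1)%N by rewrite ltnS (leq_trans _ (a_bound j)) ?leq_addr.
pose t : k.-tuple 'I_n.+1 := [tuple Ordinal (a_lt (rev_ord j)) | j < k].
have t_part : is_part t.
  apply/andP; split; last first.
    by apply/allP=> b /tnthP[j ->]; rewrite tnth_mktuple a_bound.
  apply/(sortedP 0%N) => j; rewrite size_map size_tuple => j_lt.
  have j_lt' := ltnW j_lt.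
  have nthE (r : 'I_k) : nth 0%N (map val t) r = a (rev_ord r).
    by rewrite (nth_map ord0) ?size_tuple // -tnth_nth tnth_mktuple.
  rewrite (nthE (Ordinal j_lt)) (nthE (Ordinal j_lt')); apply: a_mono => /=.
  exact: leq_sub2l.
exists (Sub t t_part); apply/val_inj/eq_from_tnth => j /=.
rewrite tnth_mktuple; apply/val_inj => /=.
by rewrite tnth_mktuple /= rev_ordK subnK.
Qed.

Lemma to_extpE (n k : nat) (x : qH n k) (la : part n k) :
  to_extp x (part_incr la) = laurent_rescale (qsign k) (x la).
Proof.
rewrite sum_ffunE (bigD1 la) //= big1 ?addr0 => [|mu mula].
  by rewrite ffunE (wedge_incr (part_incr la)) ffunE eqxx [_ *: _]mulr1.
rewrite ffunE (wedge_incr (part_incr mu)) ffunE (inj_eq (@part_incr_inj n k)).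
by rewrite (negPf mula) scaler0.
Qed.

Lemma of_extpE (n k : nat) (u : extp n k) (la : part n k) :
  of_extp u la = laurent_rescale (qsign k) (u (part_incr la)).
Proof.
rewrite sum_ffunE (bigD1 la) //= big1 ?addr0 => [|mu mula].
  by rewrite !ffunE eqxx [_ *: _]mulr1.
by rewrite !ffunE eq_sym (negPf mula) scaler0.
Qed.

Lemma to_extpK (n k : nat) : cancel (@to_extp n k) (@of_extp n k).
Proof.
by move=> x; apply/ffunP=> la; rewrite of_extpE to_extpE rescaleK ?qsign_sqr.
Qed.

Lemma of_extpK (n k : nat) : cancel (@of_extp n k) (@to_extp n k).
Proof.
move=> u; apply/ffunP=> J; have [la <-] := part_incr_surj J.
by rewrite to_extpE of_extpE rescaleK ?qsign_sqr.
Qed.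

Definition psi (n : nat) (i : 'I_n) (k : nat) (x : qH n k) : qH n k.-1 :=
  of_extp (ext_contract i (to_extp x)).

Definition psi_star (n : nat) (i : 'I_n) (k : nat) (x : qH n k) : qH n k.+1 :=
  of_extp (ext_mul i (to_extp x)).

Definition cast_qH (n k l : nat) (kl : k = l) (x : qH n k) : qH n l :=
  ecast m (qH n m) kl x.

Lemma succ_subn (n k : nat) : (0 < k)%N -> (k < n)%N ->
  (n - k).+1 = (n - k.-1)%N.
Proof. by case: k => // k _ kn; rewrite -subSn ?subSS // ltnW. Qed.

Lemma pred_subn (n k : nat) : (n - k).-1 = (n - k.+1)%N.
Proof. by rewrite subnS. Qed.

(* Main.v *)
Require Import Defs.
From HB Require Import structures.
From mathcomp Require Import all_boot all_order all_algebra.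
From mathcomp Require Import zify.
From mathcomp.multinomials Require Import mpoly.
From mathcomp.multinomials Require Import -(notations) monalg.

Set Implicit Arguments.
Unset Strict Implicit.
Unset Printing Implicit Defensive.

Import GRing.Theory.
Local Open Scope ring_scope.

(** A partition [la] in the k x (n - k) rectangle is the same thing as a
    k-element set [steps la] of indices, the vertical steps of its boundary
    path: this is the set of indices of the basis vector of the exterior power
    that corresponds to the Schubert class.  Conjugation reflects the boundary
    path, exchanging vertical and horizontal steps and reversing their order, so
    it becomes [dual]: complement the set and apply [rev_ord] ([steps_conj]).

    On these sets [psi i] removes [i] from [A] with the sign
    (-1) ^ (below A i), where [below A i] counts the elements less than [i], and
    [psi_star i] inserts [i] with the same sign ([psiE], [psi_starE]).  Removing [i]
    from a set is inserting [rev_ord i] into its dual, and conversely, so the two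
    sides of each square have matrix entries in the same places and only the
    signs are to be compared.

    The elements of [dual A] below [rev_ord i] are the mirror images of the
    non-elements of [A] above [i].  Counting the indices above [i] in two ways
    shows that their number differs from [below A i] by n - |A| - i up to the
    convention for [i] itself ([below_dual]); this difference is the exponent in
    the theorem ([wedge_coef_dual], [contract_coef_dual]).

    The quantum parameter needs no further sign: each operator changes the size
    of the sets by one, hence replaces q by -q whichever of the two
    Grassmannians it starts from, and this substitution commutes with the
    substitution in the level-rank map ([prime_subst_rescale]). *)

(** * Signed set operations and complementation *)

Definition below (n : nat) (A : {set 'I_n}) (i : 'I_n) : nat :=
  #|[set x in A | x < i]%N|.

(** Matrix entry, at row [B] and column [A], of contraction with the vector dual
    to v_i, in the basis of the exterior algebra indexed by sets. *)
Definition contract_coef (n : nat) (i : 'I_n) (A B : {set 'I_n}) : int :=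
  if (i \in A) && (B == A :\ i) then (-1) ^+ below A i else 0.

(** Matrix entry, at row [B] and column [A], of exterior multiplication by
    v_i. *)
Definition wedge_coef (n : nat) (i : 'I_n) (A B : {set 'I_n}) : int :=
  if (i \notin A) && (B == i |: A) then (-1) ^+ below A i else 0.

Definition dual (n : nat) (A : {set 'I_n}) : {set 'I_n} :=
  [set x | rev_ord x \notin A].

Lemma mem_dual (n : nat) (A : {set 'I_n}) (x : 'I_n) :
  (x \in dual A) = (rev_ord x \notin A).
Proof. by rewrite inE. Qed.

Lemma dualK (n : nat) : involutive (@dual n).
Proof. by move=> A; apply/setP=> x; rewrite !mem_dual rev_ordK negbK. Qed.

Lemma dual_eq (n : nat) (A B : {set 'I_n}) : (dual A == dual B) = (A == B).
Proof. exact/inj_eq/(inv_inj (@dualK n)). Qed.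

Lemma dualD1 (n : nat) (A : {set 'I_n}) (i : 'I_n) :
  dual (A :\ i) = rev_ord i |: dual A.
Proof.
apply/setP=> x; rewrite in_setU1 !mem_dual in_setD1 negb_and negbK.
by rewrite -(inj_eq rev_ord_inj (rev_ord x)) rev_ordK.
Qed.

Lemma dualU1 (n : nat) (A : {set 'I_n}) (i : 'I_n) :
  dual (i |: A) = dual A :\ rev_ord i.
Proof.
apply/setP=> x; rewrite in_setD1 !mem_dual in_setU1 negb_or.
by rewrite -(inj_eq rev_ord_inj (rev_ord x)) rev_ordK.
Qed.

Lemma card_sum_bool (T : finType) (P : pred T) :
  #|[set x | P x]| = (\sum_x P x)%N.
Proof. by rewrite -sum1dep_card big_mkcond. Qed.

Lemma card_ord_lt (k : nat) (r : 'I_k) : #|[set s : 'I_k | s < r]%N| = r.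
Proof.
rewrite -sum1dep_card -(big_ord_widen k (fun=> 1%N)) ?sum1_card ?card_ord //.
exact: ltnW.
Qed.

Lemma card_ord_gt (n : nat) (i : 'I_n) :
  #|[set x : 'I_n | i < x]%N| = (n - i.+1)%N.
Proof.
have -> : [set x : 'I_n | i < x]%N = @rev_ord n @: [set x : 'I_n | x < rev_ord i]%N.
  apply/setP=> x; rewrite -[x in RHS]rev_ordK (mem_imset _ _ rev_ord_inj) !inE /=.
  have := ltn_ord x; have := ltn_ord i; lia.
by rewrite (card_imset _ rev_ord_inj) card_ord_lt.
Qed.

Lemma card_dual (n : nat) (A : {set 'I_n}) : #|dual A| = (n - #|A|)%N.
Proof.
have -> : dual A = @rev_ord n @: ~: A.
  by apply/setP=> x; rewrite -[x in RHS]rev_ordK (mem_imset _ _ rev_ord_inj) !inE.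
by rewrite (card_imset _ rev_ord_inj) -[LHS](addKn #|A|) cardsC card_ord.
Qed.

(** The first summand counts the non-elements of [A] above [i]; adding the
    elements of [A] above [i] gives [n - i.+1], and adding the rest of [A] gives
    [below A i], together with [i] itself if it lies in [A]. *)
Lemma below_dual (n : nat) (A : {set 'I_n}) (i : 'I_n) :
  (below (dual A) (rev_ord i) + #|A| =
   n - i.+1 + below A i + (i \in A))%N.
Proof.
have -> : below (dual A) (rev_ord i) = #|[set x in ~: A | i < x]%N|.
  rewrite /below -(card_imset _ rev_ord_inj); congr #|pred_of_set _|.
  apply/setP=> x; rewrite -[x]rev_ordK (mem_imset _ _ rev_ord_inj) !inE !rev_ordK /=.
  have := ltn_ord x; have := ltn_ord i; case: (_ \in A) => //=; lia.
(* All cardinals become sums of indicators, which agree index by index. *)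
rewrite -(card_ord_gt i) -[#|A|]cardsE /below !card_sum_bool.
have -> : (i \in A : nat) = (\sum_x ((x \in A) && (x == i)))%N.
  by rewrite (bigD1 i) //= eqxx andbT big1 ?addn0 // => x /negPf->; rewrite andbF.
rewrite -!big_split /=; apply: eq_bigr => x _; rewrite !inE -val_eqE.
by case: (x \in A); case: ltngtP.
Qed.

Lemma sign_exchange (m : int) (c d : nat) :
  m = d%:Z - c%:Z -> (-1) ^ m * (-1) ^+ c = (-1) ^+ d :> int.
Proof.
by move=> ->; rewrite ![_ ^+ _]exprnP -exprzDr ?unitrN1 // subrK.
Qed.

Lemma wedge_coef_dual (n : nat) (i : 'I_n) (A B : {set 'I_n}) :
  wedge_coef (rev_ord i) (dual A) (dual B) =
  contract_coef i A B * (-1) ^ (n%:Z - #|A|%:Z + 1 - i.+1%:Z).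
Proof.
rewrite /wedge_coef /contract_coef mem_dual rev_ordK negbK -dualD1 dual_eq.
case: ifP => [/andP[iA _]|]; last by rewrite mul0r.
rewrite mulrC; apply/esym/sign_exchange.
have := below_dual A i; rewrite iA; have := ltn_ord i; lia.
Qed.

Lemma contract_coef_dual (n : nat) (i : 'I_n) (A B : {set 'I_n}) :
  contract_coef (rev_ord i) (dual A) (dual B) =
  wedge_coef i A B * (-1) ^ (n%:Z - #|A|%:Z - i.+1%:Z).
Proof.
rewrite /wedge_coef /contract_coef mem_dual rev_ordK -dualU1 dual_eq.
case: ifP => [/andP[iA _]|]; last by rewrite mul0r.
rewrite mulrC; apply/esym/sign_exchange.
have := below_dual A i; rewrite (negPf iA); have := ltn_ord i; lia.
Qed.

(** * Basis vectors as sets *)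

Definition support (n k : nat) (J : incr n k) : {set 'I_n} :=
  [set x in val J].

Lemma support_inj (n k : nat) : injective (@support n k).
Proof.
move=> I J /setP IJ; apply/eqP; rewrite -perm_incr.
apply: uniq_perm (incr_uniq I) (incr_uniq J) _ => x.
by have := IJ x; rewrite !inE.
Qed.

Lemma support_imset (n k : nat) (J : incr n k) :
  support J = tnth (val J) @: [set: 'I_k].
Proof.
apply/setP=> x; rewrite inE.
by apply/tnthP/imsetP => [[r ->]|[r _ ->]]; exists r.
Qed.

Lemma incr_tnth_inj (n k : nat) (J : incr n k) : injective (tnth (val J)).
Proof. by apply/tuple_uniqP/incr_uniq. Qed.

Lemma card_support (n k : nat) (J : incr n k) : #|support J| = k.
Proof.
by rewrite support_imset (card_imset _ (@incr_tnth_inj _ _ J)) cardsT card_ord.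
Qed.

Lemma support_surj (n k : nat) (A : {set 'I_n}) :
  #|A| = k -> exists J : incr n k, support J = A.
Proof.
move=> Ak; have szA : size (enum A) == k by rewrite -cardE Ak.
have srt : sorted ltn (map val (Tuple szA)).
  rewrite /= sorted_map /enum_mem sorted_filter //.
    by move=> x y z; apply: ltn_trans.
  by rewrite -enumT -sorted_map val_enum_ord iota_ltn_sorted.
by exists (Sub (Tuple szA) srt); apply/setP=> x; rewrite inE /= mem_enum.
Qed.

Lemma incr_ltE (n k : nat) (J : incr n k) (r s : 'I_k) :
  (tnth (val J) r < tnth (val J) s)%N = (r < s)%N.
Proof.
by case: (ltngtP r s) => [/incr_lt->|/(incr_lt J)/ltnW|/val_inj->];
  rewrite ?ltnn // leqNgt => /negPf.
Qed.

Lemma below_support (n k : nat) (J : incr n k) (r : 'I_k) :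
  below (support J) (tnth (val J) r) = r.
Proof.
rewrite -[RHS](card_ord_lt r) -(card_imset _ (@incr_tnth_inj _ _ J)) /below.
congr #|pred_of_set _|; apply/setP=> x; rewrite inE support_imset.
apply/andP/imsetP => [[/imsetP[s _ ->]]|[s]].
  by rewrite incr_ltE => sr; exists s; rewrite ?inE.
by rewrite inE => sr ->; rewrite imset_f ?inE // incr_ltE.
Qed.

(** As [J] increases, the only inversions of i, J_1, ..., J_k involve the first
    position. *)
Lemma inversions_cons (n k : nat) (i : 'I_n) (J : incr n k) :
  inversions [tuple of i :: val J] = below (support J) i.
Proof.
pose f (s : 'I_k) := (ord0 : 'I_k.+1, lift ord0 s).
have f_inj : injective f by move=> r s /(congr1 snd) /lift_inj.
rewrite /inversions /below.
have -> : [set x in support J | x < i]%N =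
    tnth (val J) @: [set s | tnth (val J) s < i]%N.
  apply/setP=> x; rewrite inE support_imset.
  apply/andP/imsetP => [[/imsetP[s _ ->]] si|[s]]; first by exists s; rewrite ?inE.
  by rewrite inE => si ->; rewrite imset_f ?inE.
rewrite (card_imset _ (@incr_tnth_inj _ _ J)) -(card_imset _ f_inj).
congr #|pred_of_set _|; apply/setP=> -[r s]; rewrite inE /=.
apply/andP/imsetP => [[]|[t]].
  case: (unliftP ord0 s) => [s'|] -> //; rewrite tnthS.
  case: (unliftP ord0 r) => [r'|] ->; last by exists s'; rewrite ?inE.
  by rewrite tnthS incr_ltE /= /bump; lia.
by rewrite inE => ti [-> ->]; rewrite tnth0 tnthS.
Qed.

Lemma wedge_cons (n k : nat) (i : 'I_n) (J : incr n k) (K : incr n k.+1) :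
  wedge [tuple of i :: val J] K =
  (wedge_coef i (support J) (support K))%:~R.
Proof.
rewrite ffunE inversions_cons /wedge_coef.
have -> : perm_eq [tuple of i :: val J] (val K) =
    (i \notin support J) && (support K == i |: support J).
  apply/idP/andP => [p|[iJ /eqP/setP JK]].
    have := perm_uniq p; rewrite incr_uniq inE => /andP[-> _]; split=> //.
    by apply/eqP/setP=> x; rewrite !inE -(perm_mem p) inE.
  apply: uniq_perm (incr_uniq K) _.
    by rewrite /= incr_uniq andbT; rewrite inE in iJ.
  by move=> x; have := JK x; rewrite !inE.
by case: ifP => _; rewrite ?rmorphXn ?rmorphN1 ?rmorph0.
Qed.

Lemma sorted_tnth (n k : nat) (t : k.-tuple 'I_n) :
  (forall r s : 'I_k, (r < s)%N -> (tnth t r < tnth t s)%N) ->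
  sorted ltn (map val t).
Proof.
move=> t_lt; apply/(sortedP 0%N) => j; rewrite size_map size_tuple => j1.
have j0 := ltnW j1; have x0 := tnth t (Ordinal j0).
have := t_lt (Ordinal j0) (Ordinal j1) (leqnn _).
by rewrite !(tnth_nth x0) !(nth_map x0) ?size_tuple.
Qed.

Lemma del_tuple_sorted (n k : nat) (r : 'I_k) (J : incr n k) :
  sorted ltn (map val (del_tuple r (val J))).
Proof.
apply: sorted_tnth => s t st; rewrite !tnth_mktuple incr_ltE /= /bump; lia.
Qed.

Definition del_incr (n k : nat) (r : 'I_k) (J : incr n k) : incr n k.-1 :=
  Sub (del_tuple r (val J)) (del_tuple_sorted r J).

Lemma support_del (n k : nat) (r : 'I_k) (J : incr n k) :
  support (del_incr r J) = support J :\ tnth (val J) r.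
Proof.
apply/setP=> x; rewrite in_setD1 !support_imset.
apply/imsetP/andP => [[s _ ->]|[xr /imsetP[s _ xs]]].
  rewrite tnth_mktuple imset_f ?inE // (inj_eq (@incr_tnth_inj _ _ J)).
  by rewrite eq_sym neq_lift.
move: xr; rewrite xs (inj_eq (@incr_tnth_inj _ _ J)) eq_sym => /unlift_some[t -> _].
by exists t; rewrite // tnth_mktuple.
Qed.

(** At most one position [r] contributes, the one holding [i]; the entries of [J]
    before it are those less than [i], so [r] is [below (support J) i], and
    removing one entry leaves an increasing sequence, so sorting the result
    brings in no further sign. *)
Lemma contract_incr (n k : nat) (i : 'I_n) (J : incr n k) (K : incr n k.-1) :
  (\sum_(r < k) ((-1) ^+ r * (i == tnth (val J) r)%:R) *:
      wedge (del_tuple r (val J)) : extp n k.-1) K =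
  (contract_coef i (support J) (support K))%:~R.
Proof.
rewrite sum_ffunE /contract_coef; case: ifP => [/andP[iJ /eqP KE]|notJK].
  move: iJ KE; rewrite {1}support_imset => /imsetP[r _ ->] KE.
  have -> : K = del_incr r J by apply: support_inj; rewrite KE support_del.
  rewrite (bigD1 r) //= big1 ?addr0 => [|s sr]; last first.
    rewrite (inj_eq (@incr_tnth_inj _ _ J)) eq_sym (negPf sr) mulr0 scale0r.
    by rewrite ffunE.
  rewrite ffunE (wedge_incr (del_incr r J)) ffunE !eqxx !mulr1 below_support.
  by rewrite [_ *: _]mulr1 rmorphXn rmorphN1.
rewrite big1 // => r _; rewrite ffunE (wedge_incr (del_incr r J)) ffunE.
case: eqP => [iJ|_]; last by rewrite mulr0 scale0r.
case: eqP => [JK|_]; last by rewrite scaler0.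
by move: notJK; rewrite iJ -JK support_del eqxx andbT support_imset imset_f ?inE.
Qed.

Lemma ext_mulE (n k : nat) (i : 'I_n) (u : extp n k) (K : incr n k.+1) :
  ext_mul i u K =
  \sum_J u J *~ wedge_coef i (support J) (support K).
Proof.
rewrite sum_ffunE; apply: eq_bigr => J _.
by rewrite ffunE wedge_cons [_ *: _]mulrzr.
Qed.

Lemma ext_contractE (n k : nat) (i : 'I_n) (u : extp n k) (K : incr n k.-1) :
  ext_contract i u K =
  \sum_J u J *~ contract_coef i (support J) (support K).
Proof.
rewrite sum_ffunE; apply: eq_bigr => J _.
by rewrite ffunE contract_incr [_ *: _]mulrzr.
Qed.

(** * Boundary paths of partitions *)

(** The vertical steps of the boundary path of [la], read from the lower left
    corner of the rectangle. *)
Definition steps (n k : nat) (la : part n k) : {set 'I_n} :=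
  support (part_incr la).

Lemma inj_surj_bij (S T : finType) (f : S -> T) :
  injective f -> (forall y, exists x, f x = y) -> bijective f.
Proof.
move=> f_inj f_surj; apply: (inj_card_bij f_inj).
rewrite -(card_codom f_inj); apply/subset_leq_card/subsetP=> y _.
by have [x <-] := f_surj y; apply: codom_f.
Qed.

Lemma part_incr_bij (n k : nat) : bijective (@part_incr n k).
Proof. exact: inj_surj_bij (@part_incr_inj n k) (@part_incr_surj n k). Qed.

Lemma steps_inj (n k : nat) : injective (@steps n k).
Proof. by move=> la mu /support_inj /part_incr_inj. Qed.

Lemma steps_surj (n k : nat) (A : {set 'I_n}) :
  #|A| = k -> exists la : part n k, steps la = A.
Proof.
move=> /support_surj[J <-]; have [la <-] := part_incr_surj J.
by exists la.
Qed.

Lemma card_steps (n k : nat) (la : part n k) : #|steps la| = k.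
Proof. exact: card_support. Qed.

Lemma part_le (n k : nat) (la : part n k) : (k <= n)%N.
Proof. by rewrite -(card_steps la) -[X in (_ <= X)%N](card_ord n) max_card. Qed.

Lemma ltn_count_gt (s : seq nat) (c r : nat) :
  sorted geq s -> (r < count (fun a => c < a) s)%N = (c < nth 0 s r)%N.
Proof.
elim: s r => [|a s IH] r; first by rewrite nth_nil.
move=> as_sorted; have s_sorted := path_sorted as_sorted.
have s_le : all (fun b => b <= a)%N s.
  by apply: (order_path_min _ as_sorted) => x y z yx zy; apply: leq_trans zy yx.
case: r => [|r] /=; last first.
  rewrite -(IH _ s_sorted); case: (ltnP c a) => //= ac.
  rewrite (_ : count _ s = 0%N) //; apply/eqP; rewrite -leqn0 leqNgt -has_count.
  apply/hasPn=> b /(allP s_le) ba; rewrite -leqNgt; exact: leq_trans ac.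
case: (ltnP c a) => //= ac.
rewrite add0n -has_count; apply/negP=> /hasP[b /(allP s_le) ba].
by rewrite ltnNge (leq_trans ba).
Qed.

(** The position of the vertical step in row [r]: [la_r] horizontal steps and
    the [k - r.+1] vertical steps of the rows below precede it. *)
Lemma mem_steps (n k : nat) (la : part n k) (x : 'I_n) :
  reflect (exists r : 'I_k, x = (tnth (val la) r + (k - r.+1))%N :> nat)
          (x \in steps la).
Proof.
rewrite /steps support_imset; apply: (iffP imsetP) => [[r _ ->]|[r xr]].
  exists (rev_ord r); rewrite tnth_mktuple /=.
  by rewrite -[(k - _)%N]/(val (rev_ord (rev_ord r))) rev_ordK.
by exists (rev_ord r) => //; apply: val_inj; rewrite tnth_mktuple /= rev_ordK.
Qed.

Lemma tnth_conj (n k : nat) (la : part n k) (c : 'I_(n - k)) :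
  tnth (val (conj_part la)) c = count (fun a => c < a)%N (map val (val la)) :> nat.
Proof.
rewrite tnth_mktuple count_map inordK // ltnS (leq_trans (count_size _ _)) //.
by rewrite size_tuple (part_le la).
Qed.

(** The defining Galois connection of conjugation: both sides say that the cell
    in row [r] and column [c] lies in the diagram. *)
Lemma conj_part_lt (n k : nat) (la : part n k) (r : 'I_k) (c : 'I_(n - k)) :
  (r < tnth (val (conj_part la)) c)%N = (c < tnth (val la) r)%N.
Proof.
have /andP[la_sorted _] := valP la.
by rewrite tnth_conj ltn_count_gt // (nth_map ord0) ?size_tuple // -tnth_nth.
Qed.

(** By cardinality one inclusion suffices.  If the step of column [c] in the
    conjugate were the mirror image of the step of row [r], then
    la_r + la'_c = r + c + 1.  But la_r > c and la'_c > r hold together or fail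
    together, so the sum is at least r + c + 2 or at most r + c. *)
Lemma steps_conj (n k : nat) (la : part n k) :
  steps (conj_part la) = dual (steps la).
Proof.
apply/eqP; rewrite eqEcard card_dual !card_steps leqnn andbT.
apply/subsetP=> x /mem_steps[c xc]; rewrite mem_dual.
apply/negP=> /mem_steps[r /= xr].
have := conj_part_lt la r c; have := ltn_ord x; have := ltn_ord r.
have := ltn_ord c; have := part_le la; move: xc xr.
set a := tnth _ c; set b := tnth _ r; lia.
Qed.

Lemma conj_part_inj (n k : nat) : injective (@conj_part n k).
Proof.
move=> la mu /(congr1 (@steps _ _)).
by rewrite !steps_conj => /(inv_inj (@dualK n)) /steps_inj.
Qed.

Lemma conj_part_bij (n k : nat) : (k <= n)%N -> bijective (@conj_part n k).
Proof.
move=> kn; apply: inj_surj_bij (@conj_part_inj n k) _ => mu.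
have [|la laE] := @steps_surj n k (dual (steps mu)).
  by rewrite card_dual card_steps subKn.
by exists la; apply: steps_inj; rewrite steps_conj laE dualK.
Qed.

(** * Semilinear maps in coordinates *)

Lemma laurent_rescale_is_zmod_morphism (R : comNzRingType) (s : int) :
  zmod_morphism (@laurent_rescale R s).
Proof.
by move=> f g; apply/malgP=> m; rewrite mcoeffB !mcoeff_rescale mcoeffB mulrBl.
Qed.

HB.instance Definition _ (R : comNzRingType) (s : int) :=
  GRing.isZmodMorphism.Build (laurent R) (laurent R) (@laurent_rescale R s)
    (@laurent_rescale_is_zmod_morphism R s).

Lemma rev_negB (n : nat) (a b : {mpoly int[n]}) :
  rev_neg (a - b) = rev_neg a - rev_neg b.
Proof. exact: raddfB. Qed.

Lemma rev_negMz (n : nat) (a : {mpoly int[n]}) (c : int) :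
  rev_neg (a *~ c) = rev_neg a *~ c.
Proof. exact: raddfMz. Qed.

Lemma prime_subst_is_zmod_morphism (n : nat) : zmod_morphism (@prime_subst n).
Proof.
move=> f g; apply/malgP=> m; rewrite mcoeff_prime_subst [X in rev_neg X]mcoeffB.
by rewrite rev_negB -2!mcoeff_prime_subst [RHS]mcoeffB.
Qed.

HB.instance Definition _ (n : nat) :=
  GRing.isZmodMorphism.Build (qeqring n) (qeqring n) (@prime_subst n)
    (@prime_subst_is_zmod_morphism n).

Lemma rescaleM (R : comNzRingType) (s t : int) (f : laurent R) :
  s \is a GRing.unit -> t \is a GRing.unit ->
  laurent_rescale s (laurent_rescale t f) = laurent_rescale (s * t) f.
Proof.
move=> s_unit t_unit; apply/malgP=> m; rewrite 3!mcoeff_rescale -mulrA -intrM.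
by rewrite -exprzMl // (mulrC t).
Qed.

Lemma prime_subst_rescale (n : nat) (s : int) (f : qeqring n) :
  prime_subst (laurent_rescale s f) = laurent_rescale s (prime_subst f).
Proof.
apply/malgP=> m; rewrite [LHS]mcoeff_prime_subst [RHS]mcoeff_rescale.
rewrite [X in _ = X * _]mcoeff_prime_subst [X in rev_neg X]mcoeff_rescale.
by rewrite [X in rev_neg X]mulrzr rev_negMz [RHS]mulrzr.
Qed.

Lemma qsign_unit (k : nat) : qsign k \is a GRing.unit.
Proof. by apply/unitrP; exists (qsign k); rewrite qsign_sqr. Qed.

Lemma qsignM (k : nat) : qsign k.+1 * qsign k = -1.
Proof. by rewrite /qsign exprS -mulrA -expr2 sqrr_sign mulr1. Qed.

(** Passing to z in one Grassmannian and back to q in the next one leaves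
    the substitution q := -q. *)
Lemma rescale_qsign (R : comNzRingType) (k : nat) (f : laurent R) :
  laurent_rescale (qsign k.+1) (laurent_rescale (qsign k) f) =
  laurent_rescale (-1) f.
Proof.
by rewrite (rescaleM _ (qsign_unit _) (qsign_unit _)) qsignM.
Qed.

Lemma psi_starE (n k : nat) (i : 'I_n) (x : qH n k) (nu : part n k.+1) :
  psi_star i x nu =
  \sum_la laurent_rescale (-1) (x la) *~ wedge_coef i (steps la) (steps nu).
Proof.
rewrite /psi_star of_extpE ext_mulE raddf_sum.
rewrite (reindex (@part_incr n k)); last exact/onW_bij/part_incr_bij.
by apply: eq_bigr => la _; rewrite raddfMz /= to_extpE rescale_qsign.
Qed.

Lemma psiE (n k : nat) (i : 'I_n) (x : qH n k) (nu : part n k.-1) :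
  (0 < k)%N ->
  psi i x nu =
  \sum_la laurent_rescale (-1) (x la) *~ contract_coef i (steps la) (steps nu).
Proof.
case: k x nu => // k x nu _; rewrite /psi of_extpE ext_contractE raddf_sum.
rewrite (reindex (@part_incr n k.+1)); last exact/onW_bij/part_incr_bij.
apply: eq_bigr => la _; rewrite raddfMz /= to_extpE.
by rewrite (rescaleM _ (qsign_unit _) (qsign_unit _)) mulrC qsignM.
Qed.

(** The coefficients of [psi_star] and [psi] depend on partitions only through
    their sets of steps, whose type does not mention the size; this is what makes
    the cast between equal sizes invisible. *)
Lemma cast_psi_starE (n k l : nat) (i : 'I_n) (kl : k.+1 = l) (x : qH n k)
    (nu : part n l) :
  cast_qH kl (psi_star i x) nu =
  \sum_la laurent_rescale (-1) (x la) *~ wedge_coef i (steps la) (steps nu).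
Proof. by case: l / kl nu => nu; exact: psi_starE. Qed.

Lemma cast_psiE (n k l : nat) (i : 'I_n) (kl : k.-1 = l) (x : qH n k)
    (nu : part n l) :
  (0 < k)%N ->
  cast_qH kl (psi i x) nu =
  \sum_la laurent_rescale (-1) (x la) *~ contract_coef i (steps la) (steps nu).
Proof. by case: l / kl nu => nu; exact: psiE. Qed.

Lemma Theta_conj (n k : nat) (x : qH n k) (la : part n k) :
  Theta x (conj_part la) = prime_subst (x la).
Proof.
rewrite sum_ffunE (bigD1 la) //= big1 ?addr0 => [|mu mula].
  by rewrite !ffunE eqxx [_ *: _]mulr1.
by rewrite !ffunE (inj_eq (@conj_part_inj n k)) eq_sym (negPf mula) scaler0.
Qed.

(** Both squares need this reindexing of a sum over the conjugate rectangle; the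
    coefficients [c] are those of one row of the matrix of an operator. *)
Lemma sum_Theta (n k : nat) (x : qH n k) (c : {set 'I_n} -> int) :
  (k <= n)%N ->
  \sum_la laurent_rescale (-1) (Theta x la) *~ c (steps la) =
  \sum_la prime_subst (laurent_rescale (-1) (x la)) *~ c (dual (steps la)).
Proof.
move=> kn; rewrite (reindex (@conj_part n k)); last exact/onW_bij/conj_part_bij.
by apply: eq_bigr => la _; rewrite Theta_conj steps_conj prime_subst_rescale.
Qed.

Theorem corollary4p4 (n k : nat) (i : 'I_n)
    (n_ge2 : (2 <= n)%N) (k_gt0 : (0 < k)%N) (k_ltn : (k < n)%N) :
  (forall x : qH n k,
     Theta (psi i x *~ (-1) ^ (n%:Z - k%:Z + 1 - i.+1%:Z)) =
     cast_qH (succ_subn k_gt0 k_ltn) (psi_star (rev_ord i) (Theta x))) /\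
  (forall x : qH n k,
     Theta (psi_star i x *~ (-1) ^ (n%:Z - k%:Z - i.+1%:Z)) =
     cast_qH (pred_subn n k) (psi (rev_ord i) (Theta x))).
Proof.
have k_len := ltnW k_ltn; split=> x; apply/ffunP=> mu.
  have [conj_inv _ conj_invK] := conj_part_bij (leq_trans (leq_pred k) k_len).
  rewrite -[mu]conj_invK Theta_conj cast_psi_starE.
  rewrite (sum_Theta _ (fun A => wedge_coef (rev_ord i) A _)) // ffunMzE psiE //.
  rewrite raddfMz raddf_sum mulrz_suml; apply: eq_bigr => la _ /=.
  by rewrite raddfMz -mulrzA steps_conj wedge_coef_dual card_steps.
have [conj_inv _ conj_invK] := conj_part_bij k_ltn.
have nk_gt0 : (0 < n - k)%N by rewrite subn_gt0.
rewrite -[mu]conj_invK Theta_conj cast_psiE //.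
rewrite (sum_Theta _ (fun A => contract_coef (rev_ord i) A _)) // ffunMzE psi_starE.
rewrite raddfMz raddf_sum mulrz_suml; apply: eq_bigr => la _ /=.
by rewrite raddfMz -mulrzA steps_conj contract_coef_dual card_steps.
Qed.
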